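(* Let $p$ be a prime. For each integer $\alpha>0$, the group-annihilator graph $\Gamma(\mathbb{Z}/p^{\alpha}\mathbb{Z})$ is a connected threshold graph.
   Context: For a finite abelian group $G$ viewed as a $\mathbb{Z}$-module and $x\in G$, $[x:G]=\{r\in\mathbb{Z} : rG\subseteq\mathbb{Z}x\}$. The group-annihilator graph $\Gamma(G)$ has vertex set $G$, with distinct $x,y$ adjacent iff $[x:G][y:G]G=\{0\}$ (product of ideals of $\mathbb{Z}$). A threshold graph is a graph obtained from a single vertex by repeatedly (in any order, any number of times) adding either an isolated vertex or a dominating vertex (a new vertex adjacent to all existing vertices). *)

(* Defs.v *)
From HB Require Import structures.
From mathcomp Require Import all_boot all_order all_algebra.
From mathcomp Require Import boolp classical_sets.

Set Implicit Arguments.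
Unset Strict Implicit.
Unset Printing Implicit Defensive.

Import GRing.Theory.
Local Open Scope ring_scope.
Local Open Scope classical_set_scope.

Record sgraph := SGraph {
  vertex :> finType;
  edge : rel vertex;
  edge_sym : symmetric edge;
  edge_irrefl : irreflexive edge
}.

Definition isomorphic (G H : sgraph) : Prop :=
  exists2 f : G -> H, bijective f & {mono f : x y / edge x y >-> edge x y}.

Definition connected (G : sgraph) : Prop :=
  forall x y : G, connect (@edge G) x y.

Section ThresholdGraphs.

Definition single_rel : rel unit := fun _ _ => false.

Fact single_sym : symmetric single_rel. Proof. by []. Qed.
Fact single_irrefl : irreflexive single_rel. Proof. by []. Qed.

Definition single_vertex : sgraph := SGraph single_sym single_irrefl.

Variables (dominating : bool) (G : sgraph).

(* The new vertex is None; it is adjacent to all the old vertices if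
   dominating is true, and to none of them otherwise. *)
Definition add_rel : rel (option G) := fun u v =>
  match u, v with
  | Some x, Some y => edge x y
  | None, None => false
  | _, _ => dominating
  end.

Fact add_sym : symmetric add_rel.
Proof. by case=> [x|] [y|] //=; rewrite edge_sym. Qed.

Fact add_irrefl : irreflexive add_rel.
Proof. by case=> [x|] //=; rewrite edge_irrefl. Qed.

Definition add_vertex : sgraph := SGraph add_sym add_irrefl.

End ThresholdGraphs.

Definition add_isolated : sgraph -> sgraph := add_vertex false.
Definition add_dominating : sgraph -> sgraph := add_vertex true.

Inductive threshold_construction : sgraph -> Prop :=
  | threshold_single : threshold_construction single_vertex
  | threshold_isolated G :
      threshold_construction G -> threshold_construction (add_isolated G)
  | threshold_dominating G :
      threshold_construction G -> threshold_construction (add_dominating G).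

Definition threshold (G : sgraph) : Prop :=
  exists2 H : sgraph, threshold_construction H & isomorphic G H.

(* [x : G] *)
Definition ann_ideal (G : zmodType) (x : G) : set int :=
  [set r | range (fun g : G => g *~ r) `<=` range (fun n : int => x *~ n)].

(* As usual, products of ideals, and of an ideal with a module, consist of the
   finite sums of elementwise products. *)
Definition ideal_mul (I J : set int) : set int :=
  [set r | exists2 s : seq (int * int),
     forall u, u \in s -> I u.1 /\ J u.2 & r = \sum_(u <- s) u.1 * u.2].

Definition ideal_act (I : set int) (G : zmodType) : set G :=
  [set z | exists2 s : seq (int * G),
     forall u, u \in s -> I u.1 & z = \sum_(u <- s) u.2 *~ u.1].
Arguments ideal_act : clear implicits.

Lemma ideal_mulC (I J : set int) : ideal_mul I J = ideal_mul J I.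
Proof.
wlog suff: I J / ideal_mul I J `<=` ideal_mul J I.
  by move=> sub; apply/seteqP; split; apply: sub.
move=> _ [s sIJ ->]; exists [seq (u.2, u.1) | u <- s].
  by move=> _ /mapP[u /sIJ[Iu Ju] ->].
by rewrite big_map; apply: eq_bigr => u _; rewrite mulrC.
Qed.

Section GroupAnnihilatorGraph.

Variable G : finZmodType.

Definition ann_rel : rel G := fun x y =>
  (x != y) &&
  `[< ideal_act (ideal_mul (ann_ideal x) (ann_ideal y)) G = [set 0] >].

Fact ann_sym : symmetric ann_rel.
Proof. by move=> x y; rewrite /ann_rel eq_sym ideal_mulC. Qed.

Fact ann_irrefl : irreflexive ann_rel.
Proof. by move=> x; rewrite /ann_rel eqxx. Qed.

Definition ann_graph : sgraph := SGraph ann_sym ann_irrefl.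

End GroupAnnihilatorGraph.

(* Main.v *)
Require Import Defs.
From mathcomp Require Import all_boot all_order all_algebra.
From mathcomp Require Import boolp classical_sets.

(** Since [Z/n] is cyclic, [[x:G]] consists of the integers whose image in the
    ring [Z/n] is a multiple of [x]; hence distinct [x] and [y] are adjacent
    exactly when [x * y = 0]. In particular [0] is adjacent to every other
    vertex. For [n = p ^ alpha] the condition reads [alpha <= v x + v y], with
    [v] the [p]-adic valuation. In a graph given by weights in this way, either
    a vertex of maximal weight is dominating or a vertex of minimal weight is
    isolated; deleting it leaves a graph of the same kind. *)

Set Implicit Arguments.
Unset Strict Implicit.
Unset Printing Implicit Defensive.

Import GRing.Theory.

Lemma isomorphic_trans (G H K : sgraph) :
  isomorphic G H -> isomorphic H K -> isomorphic G K.
Proof.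
move=> [f f_bij f_mono] [g g_bij g_mono]; exists (g \o f); first exact: bij_comp.
by move=> x y; rewrite /= g_mono f_mono.
Qed.

Lemma isomorphic_add_vertex b (G H : sgraph) :
  isomorphic G H -> isomorphic (add_vertex b G) (add_vertex b H).
Proof.
move=> [f [g fK gK] f_mono]; exists (omap f : add_vertex b G -> add_vertex b H).
  by exists (omap g); case=> //= x; rewrite ?fK ?gK.
by case=> [x|] [y|] //=; rewrite f_mono.
Qed.

Section DeleteVertex.

Variables (G : sgraph) (u : G).

Definition delete_rel : rel {x : G | x != u} := fun x y => edge (val x) (val y).

Fact delete_sym : symmetric delete_rel.
Proof. by move=> x y; apply: edge_sym. Qed.

Fact delete_irrefl : irreflexive delete_rel.
Proof. by move=> x; apply: edge_irrefl. Qed.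

Definition delete_vertex : sgraph := SGraph delete_sym delete_irrefl.

Lemma card_delete_vertex : #|delete_vertex| = #|G|.-1.
Proof. by rewrite card_sig cardC1. Qed.

Lemma add_delete_vertex b :
  (forall x, x != u -> edge u x = b) ->
  isomorphic G (add_vertex b delete_vertex).
Proof.
(* [insub] sends [u] to [None], the added vertex, and any other vertex to itself in the subtype. *)
move=> edge_u; pose f x : add_vertex b delete_vertex := insub x.
exists f.
  exists (oapp val u) => [x|[x|]]; rewrite /f /=.
  - by case: insubP => [v _ //|/negPn/eqP ->].
  - exact: valK.
  - by rewrite insubF // eqxx.
move=> x y; rewrite /f.
case: insubP => [v xu vx|/negPn/eqP ->];
  case: insubP => [w yu wy|/negPn/eqP ->] //=.
- by rewrite /delete_rel vx wy.
- by rewrite edge_sym edge_u.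
- by rewrite edge_u.
- by rewrite edge_irrefl.
Qed.

Lemma threshold_delete_vertex b :
  (forall x, x != u -> edge u x = b) ->
  threshold delete_vertex -> threshold G.
Proof.
move=> /add_delete_vertex G_iso [H H_thr H_iso].
exists (add_vertex b H); first by case: b {G_iso}; constructor.
exact: isomorphic_trans G_iso (isomorphic_add_vertex b H_iso).
Qed.

End DeleteVertex.

Lemma threshold_card1 (G : sgraph) : #|G| = 1%N -> threshold G.
Proof.
move=> G1; exists single_vertex; first exact: threshold_single.
have [u G_u] := fintype1 G1.
exists (fun=> tt : single_vertex).
  by exists (fun=> u) => [x|[]] //; rewrite (G_u x).
by move=> x y; rewrite (G_u x) (G_u y) !edge_irrefl.
Qed.

Lemma threshold_weighted (G : sgraph) (w : G -> nat) (t : nat) :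
  (0 < #|G|)%N ->
  (forall x y : G, edge x y = (x != y) && (t <= w x + w y)%N) ->
  threshold G.
Proof.
move: {2}#|G|.-1 (erefl #|G|.-1) => n; elim: n G w => [|n IHn] G w Gn G_gt0 Gw.
  by apply: threshold_card1; rewrite -(prednK G_gt0) Gn.
have delete_thr (u : G) : threshold (delete_vertex u).
  apply: (IHn _ (fun x : delete_vertex u => w (val x)));
    rewrite ?card_delete_vertex ?Gn //.
  by move=> x y; rewrite /= /delete_rel Gw.
have [u0 _] := card_gt0P G_gt0.
have [u _ u_max] := @arg_maxnP G u0 xpredT w isT.
have [v _ v_min] := @arg_minnP G u0 xpredT w isT.
(* If the largest and smallest weights sum to at least [t], so do [w u] and any weight; if not,
   [w v] plus any weight stays below [t]. *)
case: (leqP t (w u + w v)) => uv.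
  apply: (@threshold_delete_vertex G u true) => // x xu.
  by rewrite Gw eq_sym xu (leq_trans uv) // leq_add2l v_min.
apply: (@threshold_delete_vertex G v false) => // x xv.
rewrite Gw eq_sym xv /=; apply/negbTE; rewrite -ltnNge.
by apply: leq_ltn_trans uv; rewrite addnC leq_add2r; apply: u_max.
Qed.

Local Open Scope ring_scope.

(** The inclusion need only be tested at [g = 1], a generator of ['Z_n]. Ring multiples of [x] are
    integer multiples, since every residue has an integer representative. *)
Lemma ann_ideal_Zp (n : nat) (x : 'Z_n) (r : int) :
  ann_ideal x r <-> exists c : 'Z_n, r%:~R = x * c.
Proof.
split=> [/(_ r%:~R)[]|[c rE] _ [g _ <-]]; first by exists 1.
  by move=> m _ <-; exists m%:~R; rewrite mulrzr.
exists (Posz (c * g)%R) => //.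
by rewrite -[RHS]mulrzr rE -pmulrn -mulr_natr natr_Zp [RHS]mulrC mulrA.
Qed.

Lemma ann_rel_Zp (n : nat) (x y : 'Z_n) :
  ann_rel x y = (x != y) && (x * y == 0).
Proof.
rewrite /ann_rel; congr andb; apply/asboolP/eqP => [xy0|xy0].
  (* The representative of [z] lies in the annihilator ideal of [z], so the product of those of [x]
     and [y], acting on [1], puts [x * y] in the zero module. *)
  have val_ann (z : 'Z_n) : ann_ideal z (Posz z).
    by apply/ann_ideal_Zp; exists 1; rewrite mulr1 -pmulrn natr_Zp.
  suff: [set (0 : 'Z_n)]%classic (x * y) by [].
  rewrite -xy0; exists [:: (Posz x * Posz y, 1)].
    move=> u; rewrite inE => /eqP ->; exists [:: (Posz x, Posz y)].
      by move=> v; rewrite inE => /eqP ->.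
    by rewrite big_seq1.
  by rewrite big_seq1 /= intrM -!pmulrn !natr_Zp.
apply/seteqP; split=> [_ [s sP ->]|_ ->]; last by exists [::]; rewrite ?big_nil.
rewrite big_seq big1 // => u /sP[s' s'P ->].
(* An integer of the product ideal is a sum of terms with image [(x * c) * (y * d)], hence is zero
   in ['Z_n]. *)
rewrite -mulrzr rmorph_sum big_seq big1 ?mulr0 // => v /s'P[].
move=> /ann_ideal_Zp[c cE] /ann_ideal_Zp[d dE].
by rewrite rmorphM /= cE dE mulrACA xy0 mul0r.
Qed.

Lemma Zp_mul_eq0 (n : nat) (x y : 'Z_n) :
  (1 < n)%N -> (x * y == 0) = (n %| x * y)%N.
Proof.
(* The modulus of ['Z_n] is [n.-2.+2], which equals [n] only for [n > 1]. *)
move=> n_gt1; rewrite -val_eqE /= /dvdn; congr (_ %% _ == _)%N.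
exact: Zp_cast.
Qed.

Lemma connected_ann_graph_Zp (n : nat) : connected (ann_graph 'Z_n).
Proof.
have to0 x : connect (@edge (ann_graph 'Z_n)) x 0.
  have [-> //|x0] := eqVneq x 0.
  by apply: connect1; rewrite /= ann_rel_Zp x0 mulr0 eqxx.
move=> x y; apply: connect_trans (to0 x) _.
by rewrite (sym_connect_sym (@edge_sym _)).
Qed.

Theorem theorem5 (p alpha : nat) (p_prime : prime p) (alpha_gt0 : (0 < alpha)%N) :
  connected (ann_graph 'Z_(p ^ alpha)) /\ threshold (ann_graph 'Z_(p ^ alpha)).
Proof.
split; first exact: connected_ann_graph_Zp.
have n_gt1 : (1 < p ^ alpha)%N by rewrite -(exp1n alpha) ltn_exp2r ?prime_gt1.
(* [logn p 0] is [0], but the vertex [0] needs the largest weight. *)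
pose w (x : 'Z_(p ^ alpha)) := if x == 0 then alpha else logn p x.
apply: (@threshold_weighted (ann_graph 'Z_(p ^ alpha)) w alpha).
  by apply/card_gt0P; exists 0.
move=> x y; rewrite /= ann_rel_Zp; congr andb; rewrite /w.
have [->|x0] := eqVneq x 0; first by rewrite mul0r eqxx leq_addr.
have [->|y0] := eqVneq y 0; first by rewrite mulr0 eqxx leq_addl.
have x_gt0 : (0 < x)%N by rewrite lt0n.
have y_gt0 : (0 < y)%N by rewrite lt0n.
(* Both representatives are positive, so [logn p] is additive on them and detects divisibility by
   [p ^ alpha]. *)
by rewrite Zp_mul_eq0 // pfactor_dvdn ?muln_gt0 ?x_gt0 // lognM.
Qed.
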